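(* Let $\mathbf{P}_\Sigma$ be a complete simplicial toric variety of dimension $d$ defined by a fan $\Sigma$ with $n$ one-dimensional cones, and let $Z(\Sigma)\subset\mathbf{A}^n$ be the closed subvariety attached to $\Sigma$ (defined in the context). Then either (1) $2\le \operatorname{codim} Z(\Sigma)\le [\tfrac12 d]+1$, or (2) $n=d+1$ and $Z(\Sigma)=\{0\}$.
   Context: Let $M$ be a free abelian group of rank $d$ and $N=\operatorname{Hom}(M,\mathbf{Z})$. $\Sigma$ is a rational simplicial complete $d$-dimensional fan in $N_{\mathbf{R}}$, with one-dimensional cones $\rho_1,\dots,\rho_n$; $\mathbf{P}_\Sigma$ is the associated toric variety over $\mathbf{C}$. Put $S(\Sigma)=\mathbf{C}[z_1,\dots,z_n]$ (one variable $z_i$ for each $\rho_i$) and $\mathbf{A}^n=\operatorname{Spec}S(\Sigma)$. For $\sigma\in\Sigma$ let $\widehat z_\sigma=\prod_{\rho_i\not\subset\sigma}z_i$, let $B(\Sigma)=\langle\widehat z_\sigma:\sigma\in\Sigma\rangle\subset S(\Sigma)$, and let $Z(\Sigma)=\mathbf{V}(B(\Sigma))\subset\mathbf{A}^n$ be its zero set. $\operatorname{codim}$ is codimension in $\mathbf{A}^n$, and $[x]$ denotes the integer part of $x$. *)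

(* Defs.v *)
From HB Require Import structures.
From mathcomp Require Import all_boot all_order all_algebra.
From mathcomp Require Import boolp classical_sets functions cardinality reals.
From mathcomp Require Import constructive_ereal ereal.
From mathcomp Require Import complex.
(* The notations of mpoly and constructive_ereal declare incompatible levels,
   so those of mpoly are left out. *)
From mathcomp Require Import -(notations) mpoly.

Set Implicit Arguments.
Unset Strict Implicit.
Unset Printing Implicit Defensive.

Import Order.TTheory GRing.Theory Num.Theory.
Local Open Scope classical_set_scope.
Local Open Scope ring_scope.

(* A basis of M is fixed, so that N = 'rV[int]_d, N_R = 'rV[R]_d and
   M_R = 'cV[R]_d, with the pairing given by the matrix product. *)
Section Fans.
Variables (R : realType) (d : nat).
Local Notation NR := 'rV[R]_d.

(* The generators are the rows of A; l has nonnegative coordinates. *)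
Definition cone_of (m : nat) (A : 'M[R]_(m, d)) : set NR :=
  [set v | exists2 l : 'rV[R]_m, forall i, 0 <= l 0 i & v = l *m A].

Definition rational_polyhedral (sigma : set NR) : Prop :=
  exists m (A : 'M[int]_(m, d)), sigma = cone_of (map_mx intr A).

Definition strongly_convex (sigma : set NR) : Prop :=
  forall v, sigma v -> sigma (- v) -> v = 0.

Definition is_face (tau sigma : set NR) : Prop :=
  exists2 u : 'cV[R]_d,
    (forall v, sigma v -> 0 <= (v *m u) 0 0) &
    tau = sigma `&` [set v | (v *m u) 0 0 = 0].

Record is_fan (Sigma : set (set NR)) : Prop := {
  fan_finite : finite_set Sigma ;
  fan_nonempty : Sigma !=set0 ;
  fan_rational : forall sigma, Sigma sigma -> rational_polyhedral sigma ;
  fan_strongly_convex : forall sigma, Sigma sigma -> strongly_convex sigma ;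
  fan_face : forall sigma tau, Sigma sigma -> is_face tau sigma -> Sigma tau ;
  fan_meet : forall sigma tau, Sigma sigma -> Sigma tau ->
    is_face (sigma `&` tau) sigma /\ is_face (sigma `&` tau) tau
}.

Definition complete_fan (Sigma : set (set NR)) : Prop :=
  \bigcup_(sigma in Sigma) sigma = setT.

Definition simplicial_cone (sigma : set NR) : Prop :=
  exists m (A : 'M[R]_(m, d)), row_free A /\ sigma = cone_of A.

Definition simplicial_fan (Sigma : set (set NR)) : Prop :=
  forall sigma, Sigma sigma -> simplicial_cone sigma.

(* U is the linear span of sigma. *)
Definition has_dim (sigma : set NR) (k : nat) : Prop :=
  exists U : {vspace NR},
    [/\ sigma `<=` [set` U],
        forall W : {vspace NR}, sigma `<=` [set` W] -> (U <= W)%VS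
      & \dim U = k].

Definition enumerates_rays (n : nat) (Sigma : set (set NR))
    (rho : 'I_n -> set NR) : Prop :=
  injective rho /\ range rho = [set tau | Sigma tau /\ has_dim tau 1].

End Fans.

Section Zariski.
Variables (R : realType) (n : nat).
Local Notation C := R[i].
Local Notation S := (mpoly n C).
Local Notation An := 'rV[C]_n.

Definition ideal_gen (G : set S) : set S :=
  [set f | exists2 s : seq (S * S),
     forall p, p \in s -> G p.2 & f = \sum_(p <- s) p.1 * p.2].

Definition zero_set (I : set S) : set An :=
  [set x | forall f, I f -> meval (x 0) f = 0].

Definition zclosed (Y : set An) : Prop := exists I : set S, Y = zero_set I.

Definition zirreducible (Y : set An) : Prop :=
  [/\ Y !=set0, zclosed Y &
      forall A B, zclosed A -> zclosed B -> Y = A `|` B -> Y = A \/ Y = B].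

(* Y = F 0 `<` F 1 `<` ... `<` F k; the values of F beyond k are irrelevant. *)
Definition chain_from (Y : set An) (k : nat) : Prop :=
  exists F : nat -> set An,
    [/\ F 0%N = Y, forall i, (i <= k)%N -> zirreducible (F i) &
        forall i, (i < k)%N -> F i `<` F i.+1].

Definition codim_irr (Y : set An) : \bar R :=
  ereal_sup [set k%:R%:E | k in chain_from Y].

(* The codimension of the empty set is +oo. *)
Definition codim (Z : set An) : \bar R :=
  ereal_inf [set codim_irr Y | Y in [set Y | zirreducible Y /\ Y `<=` Z]].

End Zariski.

Section ZSigma.
Variables (R : realType) (d n : nat).
Variables (Sigma : set (set 'rV[R]_d)) (rho : 'I_n -> set 'rV[R]_d).

Definition zhat (sigma : set 'rV[R]_d) : mpoly n R[i] :=
  \prod_(i < n | ~~ `[< rho i `<=` sigma >]) mpolyX R[i] (mnm1 i).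

Definition B_ideal : set (mpoly n R[i]) :=
  ideal_gen [set zhat sigma | sigma in Sigma].

Definition Z_locus : set 'rV[R[i]]_n := zero_set B_ideal.

End ZSigma.

(* Main.v *)
(* An irreducible closed set in Z(Sigma) lies in a coordinate subspace of
   codimension 2, since a single ray spans a cone; this gives the lower bound.
   A set G of rays contained in no cone gives a coordinate subspace inside
   Z(Sigma) of codimension #|G|, which is at least codim Z(Sigma): along a chain
   of irreducible closed sets the growth exponent of the affine Hilbert function
   increases at each step and stays at most n.
   Suppose then that any [d/2]+1 rays lie in a common cone. If n >= d+2, the
   relations among d+2 ray generators form a space of dimension at least 2, and
   moving inside it from a relation to its opposite one meets a nonzero relation
   with at most [d/2]+1 positive and at most [d/2]+1 negative coefficients.
   Its two sides are one point of two cones, so all rays involved lie in a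
   single cone, where they are independent: a contradiction. Hence n = d+1, the
   relation is unique up to scaling with all coefficients of the same sign, and
   any d rays span a cone, i.e. Z(Sigma) = {0}. *)
Require Import Defs.
From HB Require Import structures.
From mathcomp Require Import all_boot all_order all_algebra.
From mathcomp Require Import boolp classical_sets functions cardinality reals.
From mathcomp Require Import constructive_ereal ereal.
From mathcomp Require Import complex.
From mathcomp Require Import -(notations) mpoly.

Set Implicit Arguments.
Unset Strict Implicit.
Unset Printing Implicit Defensive.

Import Order.TTheory GRing.Theory Num.Theory.
Local Open Scope classical_set_scope.
Local Open Scope ring_scope.

(** * Linear relations with few coefficients of each sign *)

Lemma exists_left_kernel (F : fieldType) m p (E : 'M[F]_(m, p)) :
  (p < m)%N -> exists2 v : 'rV_m, v != 0 & v *m E = 0.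
Proof.
move=> pm; have /rowV0Pn[v /sub_kermxP vE v0] : kermx E != 0.
  rewrite -mxrank_eq0 mxrank_ker -lt0n subn_gt0.
  exact: leq_ltn_trans (rank_leq_col E) pm.
by exists v.
Qed.

Section BalancedRelation.
Variables (F : realFieldType) (m p k : nat) (E : 'M[F]_(m, p)).

Definition pos_support (r : 'rV[F]_m) : {set 'I_m} := [set i | 0 < r 0 i].
Definition neg_support (r : 'rV[F]_m) : {set 'I_m} := [set i | r 0 i < 0].

Lemma pos_supportN r : pos_support (- r) = neg_support r.
Proof. by apply/setP=> i; rewrite !inE mxE oppr_gt0. Qed.

Lemma neg_supportN r : neg_support (- r) = pos_support r.
Proof. by apply/setP=> i; rewrite !inE mxE oppr_lt0. Qed.

Definition balanced_relation (r : 'rV[F]_m) :=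
  [/\ r != 0, r *m E = 0, (#|pos_support r| <= k)%N & (#|neg_support r| <= k)%N].

Hypothesis mk : (m <= k.*2.+1)%N.

(* Cancelling a coordinate at which r is positive and s negative gives a
   relation which can replace r or s, with fewer such coordinates. *)
Lemma pencil_balanced_relation h (r s : 'rV[F]_m) :
  (#|pos_support r :&: neg_support s| <= h)%N ->
  r *m E = 0 -> s *m E = 0 ->
  (forall a b, a *: r + b *: s = 0 -> a = 0 /\ b = 0) ->
  (k < #|pos_support r|)%N -> (k < #|neg_support s|)%N ->
  exists u, balanced_relation u.
Proof.
elim: h r s => [|h IHh] r s hcard rE sE indep kr ks.
  (* The two supports are now disjoint, and together they would have at least [2k + 2] elements,
     more than [m]. *)
  have := cardsUI (pos_support r) (neg_support s).
  move: hcard; rewrite leqn0 => /eqP->; rewrite addn0 => cU.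
  have := max_card (mem (pos_support r :|: neg_support s)); rewrite card_ord cU.
  move=> /leq_trans/(_ mk); rewrite leqNgt -addnn => /negP[].
  by rewrite -addnS -addSn leq_add.
have [I0|[ i]] := set_0Vmem (pos_support r :&: neg_support s).
  by apply: (IHh r s) => //; rewrite I0 cards0.
rewrite !inE => /andP[ri si].
(* Both weights are positive. Hence [u > 0] where [s < 0] forces [r > 0], and [u < 0] where [r > 0]
   forces [s < 0]: no new conflicting coordinate appears, and [i] disappears. *)
pose u := (- s 0 i) *: r + r 0 i *: s.
have ui : u 0 i = 0 by rewrite !mxE mulNr mulrC addNr.
have uE : u *m E = 0 by rewrite mulmxDl -!scalemxAl rE sE !scaler0 addr0.
have u0 : u != 0.
  by apply/eqP => /indep[_ /eqP]; rewrite gt_eqF.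
have si0 : 0 < - s 0 i by rewrite oppr_gt0.
have [ku|ku] := leqP #|pos_support u| k; last first.
  apply: (IHh u s) => //; last first.
  - move=> a b; rewrite scalerDr !scalerA -addrA -scalerDl => /indep[/eqP].
    rewrite mulf_eq0 (gt_eqF si0) orbF => /eqP->.
    by rewrite mul0r add0r.
  - rewrite -ltnS; apply: leq_trans hcard; apply/proper_card/properP; split.
      apply/fintype.subsetP=> j; rewrite !inE => /andP[uj sj]; rewrite sj andbT.
      rewrite -(pmulr_rgt0 _ si0); apply: lt_le_trans uj _.
      by rewrite !mxE gerDl pmulr_rle0 // ltW.
    by exists i; rewrite !inE ?ri ?si // ui ltxx.
have [ku'|ku'] := leqP #|neg_support u| k; first by exists u.
apply: (IHh r u) => //; last first.
- move=> a b; rewrite scalerDr !scalerA addrA -scalerDl => /indep[+ /eqP].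
  rewrite mulf_eq0 (gt_eqF ri) orbF => + /eqP b0.
  by rewrite b0 mul0r addr0.
- rewrite -ltnS; apply: leq_trans hcard; apply/proper_card/properP; split.
    apply/fintype.subsetP=> j; rewrite !inE => /andP[rj uj]; rewrite rj /=.
    rewrite -(pmulr_rlt0 _ ri); apply: le_lt_trans uj.
    by rewrite !mxE lerDr pmulr_rge0 // ltW.
  by exists i; rewrite !inE ?ri ?si // ui ltxx.
Qed.

(** There are two independent relations. If neither is balanced, signs can be chosen so that one has
    more than [k] positive and the other more than [k] negative coefficients, and the pencil they
    span contains a balanced one. *)
Lemma exists_balanced_relation : (p.+1 < m)%N -> exists r, balanced_relation r.
Proof.
move=> pm; have [r r0 rE] := exists_left_kernel E (ltnW pm).
have [i ri] : exists i, r 0 i != 0 by exact/rV0Pn.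
(* The extra column forces [s] to vanish at [i], where [r] does not, so [r] and [s] are
   independent. *)
have [|s s0] := exists_left_kernel (row_mx E (delta_mx i (ord0 : 'I_1))) _.
  by rewrite addn1.
rewrite mul_mx_row => /eqP; rewrite row_mx_eq0 => /andP[/eqP sE /eqP si].
have {}si : s 0 i = 0.
  have /matrixP/(_ 0 0) := si; rewrite mxE (bigD1 i) //= big1 ?addr0.
    by rewrite !mxE !eqxx mulr1.
  by move=> j ji; rewrite !mxE (negPf ji) mulr0.
have orient (t : 'rV_m) : t != 0 -> t *m E = 0 ->
    (exists u, balanced_relation u) \/
    exists2 b : bool, (k < #|pos_support ((-1) ^+ b *: t)|)%N
      & (k < #|neg_support ((-1) ^+ (~~ b) *: t)|)%N.
  move=> t0 tE; have [kp|kp] := leqP #|pos_support t| k; last first.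
    by right; exists false; rewrite /= ?expr0 ?expr1 ?scaleN1r ?scale1r ?neg_supportN.
  have [kn|kn] := leqP #|neg_support t| k; first by left; exists t.
  by right; exists true; rewrite /= ?expr0 ?expr1 ?scaleN1r ?scale1r ?pos_supportN.
have [//|[b kr _]] := orient r r0 rE.
have [//|[c _ ks]] := orient s s0 sE.
apply: pencil_balanced_relation (leqnn _) _ _ _ kr ks.
- by rewrite -scalemxAl rE scaler0.
- by rewrite -scalemxAl sE scaler0.
move=> x y; rewrite !scalerA => xy.
have /matrixP/(_ 0 i) := xy; rewrite !mxE si mulr0 addr0 => /eqP.
rewrite mulf_eq0 (negPf ri) orbF mulf_eq0 signr_eq0 orbF => /eqP x0.
move: xy; rewrite x0 mul0r scale0r add0r => /eqP.
by rewrite scaler_eq0 (negPf s0) orbF mulf_eq0 signr_eq0 orbF => /eqP.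
Qed.

End BalancedRelation.

(** * Rays and simplicial cones *)

Section Cones.
Variables (R : realType) (d : nat).
Implicit Types sigma tau : set 'rV[R]_d.

Definition ray (e : 'rV[R]_d) : set 'rV[R]_d :=
  [set v | exists2 t, 0 <= t & v = t *: e].

Lemma ray_refl e : ray e e.
Proof. by exists 1; rewrite ?ler01 ?scale1r. Qed.

Lemma ray_scale t e : 0 < t -> ray (t *: e) = ray e.
Proof.
move=> t0; apply/seteqP; split=> _ [s s0 ->].
  by exists (s * t); rewrite ?scalerA // mulr_ge0 // ltW.
by exists (s / t); rewrite ?scalerA ?mulfVK ?gt_eqF // divr_ge0 // ltW.
Qed.

Lemma cone_of_row m (A : 'M[R]_(m, d)) i : cone_of A (row i A).
Proof.
exists (delta_mx 0 i); last by rewrite rowE.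
by move=> j; rewrite mxE; case: (_ && _); rewrite ?ler01.
Qed.

Lemma cone_of0 m (A : 'M[R]_(m, d)) : cone_of A 0.
Proof. by exists 0; rewrite ?mul0mx // => i; rewrite mxE. Qed.

Lemma cone_ofZ m (A : 'M[R]_(m, d)) t v : 0 <= t -> cone_of A v -> cone_of A (t *: v).
Proof.
move=> t0 [l l0 ->]; exists (t *: l); rewrite ?scalemxAl //.
by move=> i; rewrite mxE mulr_ge0.
Qed.

Lemma cone_ofD m (A : 'M[R]_(m, d)) v w :
  cone_of A v -> cone_of A w -> cone_of A (v + w).
Proof.
move=> [l l0 ->] [l' l0' ->]; exists (l + l'); rewrite ?mulmxDl //.
by move=> i; rewrite mxE addr_ge0.
Qed.

Lemma cone_of_sum m (A : 'M[R]_(m, d)) (I : finType) (P : pred I) (c : I -> R) v :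
  (forall i, P i -> 0 <= c i) -> (forall i, P i -> c i != 0 -> cone_of A (v i)) ->
  cone_of A (\sum_(i | P i) c i *: v i).
Proof.
move=> c0 vA; elim/big_rec: _ => [|i x Pi xA]; first exact: cone_of0.
apply: cone_ofD xA; have [->|ci] := eqVneq (c i) 0; first by rewrite scale0r; exact: cone_of0.
by apply: cone_ofZ; [exact: c0|exact: vA].
Qed.

Lemma row_free_row_neq0 m (A : 'M[R]_(m, d)) i : row_free A -> row i A != 0.
Proof.
move=> fA; rewrite rowE; apply/eqP; rewrite -(mul0mx _ A) => /(row_free_inj fA).
by move=> /matrixP/(_ 0 i); rewrite !mxE !eqxx => /eqP; rewrite oner_eq0.
Qed.

(** A free generator matrix of such a cone has exactly one row: no row would give dimension 0, and a
    second row would be a multiple of the first. *)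
Lemma simplicial_dim1 sigma : simplicial_cone sigma -> has_dim sigma 1 ->
  exists2 e, e != 0 & sigma = ray e.
Proof.
move=> [m [A [fA ->]]] [U [AU Umin dU]].
case: m A fA AU Umin => [|m] A fA AU Umin.
  have /dimvS : (U <= 0)%VS.
    apply: Umin => _ [l _ ->] /=; by rewrite thinmx0 mul0mx memv0.
  by rewrite dU dimv0.
pose e := row 0 A; have e0 : e != 0 by exact: row_free_row_neq0.
have Ue : (U = <[e]>)%VS.
  apply/eqP; rewrite eq_sym eqEdim dU dim_vline e0 leqnn andbT -memvE.
  exact/AU/cone_of_row.
case: m A fA AU Umin @e e0 Ue => [|m] A fA AU Umin e e0 Ue; last first.
  have /AU := cone_of_row A 1; rewrite /= Ue => /vlineP[t].
  rewrite /e !rowE scalemxAl => /(row_free_inj fA)/matrixP/(_ 0 1).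
  by rewrite !mxE !eqxx mulr0 => /eqP; rewrite oner_eq0.
exists e => //; apply/seteqP; split=> [_ [l l0 ->]|_ [t t0 ->]].
  exists (l 0 0) => //; apply/rowP=> j.
  by rewrite !mxE big_ord1.
exact: cone_ofZ t0 (cone_of_row _ _).
Qed.

Lemma has_dim_ray e : e != 0 -> has_dim (ray e) 1.
Proof.
move=> e0; exists <[e]>%VS; split.
- by move=> _ [t _ ->] /=; exact/memvZ/memv_line.
- by move=> W eW; rewrite -memvE; exact/eW/ray_refl.
- by rewrite dim_vline e0.
Qed.

Lemma is_face_ray_row m (A : 'M[R]_(m, d)) i :
  row_free A -> is_face (ray (row i A)) (cone_of A).
Proof.
(* As [A] is row-free, this functional can be prescribed on its rows: 0 on row [i] and 1 on the
   others. *)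
move=> fA; pose u : 'cV[R]_d := pinvmx A *m \col_j (j != i)%:R.
have uE (l : 'rV_m) : (l *m A *m u) 0 0 = \sum_(j | j != i) l 0 j.
  rewrite /u mulmxA mulmxKp // !mxE [RHS]big_mkcond.
  by apply: eq_bigr => j _; rewrite !mxE; case: eqP; rewrite ?mulr0 ?mulr1.
exists u.
  by move=> _ [l l0 ->]; rewrite uE sumr_ge0.
apply/seteqP; split.
  move=> _ [t t0 ->]; split; first exact: cone_ofZ t0 (cone_of_row _ _).
  rewrite /= rowE scalemxAl uE big1 // => j ji.
  by rewrite !mxE (negPf ji) andbF mulr0.
move=> _ [[l l0 ->]] /=; rewrite uE => /eqP; rewrite psumr_eq0 // => /allP l0'.
exists (l 0 i) => //; rewrite rowE scalemxAl; congr (_ *m _).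
apply/rowP=> j; rewrite !mxE eqxx /=; have [->|ji] := eqVneq j i; first by rewrite mulr1.
by rewrite mulr0; apply/eqP/(implyP (l0' j _)); rewrite ?mem_index_enum.
Qed.

End Cones.

(** * Ray generators in the cones of a simplicial fan *)

Section FanRelations.
Variables (R : realType) (d n : nat).
Variables (Sigma : set (set 'rV[R]_d)) (rho : 'I_n -> set 'rV[R]_d).
Hypotheses (fanS : is_fan Sigma) (simplS : simplicial_fan Sigma).
Hypothesis (raysS : enumerates_rays Sigma rho).

Lemma fan_ray i : Sigma (rho i) /\ has_dim (rho i) 1.
Proof. by have : range rho (rho i) by [exists i]; rewrite raysS.2. Qed.

Lemma exists_ray_generators :
  exists e : 'I_n -> 'rV[R]_d, forall i, e i != 0 /\ rho i = ray (e i).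
Proof.
suff /choice[e eE] : forall i, exists v, v != 0 /\ rho i = ray v by exists e.
move=> i; have [Si di] := fan_ray i.
by have [v v0 vE] := simplicial_dim1 (simplS Si) di; exists v.
Qed.

Variable e : 'I_n -> 'rV[R]_d.
Hypotheses (e_neq0 : forall i, e i != 0) (rhoE : forall i, rho i = ray (e i)).

Lemma ray_sub_cone sigma i : Sigma sigma -> (rho i `<=` sigma) = sigma (e i).
Proof.
move=> Ss; have [m [A [_ sE]]] := simplS Ss; subst sigma.
apply/propext; split=> [|ei]; first by apply; rewrite rhoE; exact: ray_refl.
by rewrite rhoE => _ [t t0 ->]; exact: cone_ofZ.
Qed.

(** The ray is the intersection of two cones of the fan, hence a face of [cone_of A]. Its functional
    is nonnegative on all rows and kills [e i], so it kills every row with nonzero coefficient in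
    [e i]; such a row lies on the ray. *)
Lemma ray_generator_row m (A : 'M[R]_(m, d)) i :
  Sigma (cone_of A) -> row_free A -> cone_of A (e i) ->
  exists r, exists2 t, 0 < t & row r A = t *: e i.
Proof.
move=> SA fA ei; have rA : rho i `<=` cone_of A by rewrite ray_sub_cone.
have [u u0] := (fan_meet fanS SA (fan_ray i).1).1.
rewrite setIidr // rhoE => uE.
have [l l0 elA] := ei.
have [r lr] : exists r, l 0 r != 0.
  by apply/rV0Pn; apply: contraNneq (e_neq0 i) => l00; rewrite elA l00 mul0mx.
have : ray (e i) (e i) by exact: ray_refl.
rewrite uE => -[_ /= eu].
have : row r A *m u = 0.
  have Au j : 0 <= (A *m u) j 0.
    by have := u0 _ (cone_of_row A j); rewrite -row_mul mxE.
  move: eu; rewrite elA -mulmxA mxE => /eqP; rewrite psumr_eq0 => [|j _]; last exact: mulr_ge0.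
  move=> /allP/(_ r); rewrite mem_index_enum mulf_eq0 (negPf lr) => /(_ isT)/eqP Aur.
  by apply/matrixP=> j k; rewrite !ord1 -row_mul mxE Aur mxE.
move=> Aru; have : ray (e i) (row r A).
  by rewrite uE; split; [exact: cone_of_row|rewrite /= Aru mxE].
move=> [t t0 At]; exists r, t => //; rewrite lt_neqAle t0 andbT eq_sym.
apply: contraTneq (row_free_row_neq0 r fA) => t00.
by rewrite At t00 scale0r eqxx.
Qed.

Lemma ray_generator_inj i j t : e i = t *: e j -> 0 <= t -> i = j.
Proof.
move=> eij t0; apply: raysS.1; rewrite !rhoE eij ray_scale // lt_neqAle t0 andbT eq_sym.
by apply: contraTneq (e_neq0 i) => t00; rewrite eij t00 scale0r eqxx.
Qed.

(** Up to positive factors, the generators lying in [sigma] are distinct rows of a row-free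
    matrix. *)
Lemma cone_rays_free sigma (c : 'I_n -> R) : Sigma sigma ->
  (forall i, c i != 0 -> sigma (e i)) -> \sum_i c i *: e i = 0 -> forall i, c i = 0.
Proof.
move=> Ss cs ce i; have [m [A [fA sE]]] := simplS Ss; subst sigma.
apply/eqP/negPn/negP => ci0.
have [r0 _] := ray_generator_row Ss fA (cs _ ci0).
(* The index [r0], available because [c i] is nonzero, is a default where [c j] vanishes. *)
have /choice[f fE] : forall j, exists rt : 'I_m * R,
    c j != 0 -> 0 < rt.2 /\ row rt.1 A = rt.2 *: e j.
  move=> j; have [cj|cj] := eqVneq (c j) 0; first by exists (r0, 0).
  by have [r [t t0 rE]] := ray_generator_row Ss fA (cs _ cj); exists (r, t).
pose l : 'rV[R]_m := \sum_(j | c j != 0) (c j / (f j).2) *: delta_mx 0 (f j).1.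
have : l *m A = 0.
  rewrite mulmx_suml -[RHS]ce [RHS](bigID (fun j => c j != 0)) /=.
  rewrite [X in _ + X]big1 ?addr0 => [|j /negPn/eqP->]; last by rewrite scale0r.
  apply: eq_bigr => j cj; have [t0 rE] := fE _ cj.
  by rewrite -scalemxAl -rowE rE scalerA mulfVK ?gt_eqF.
rewrite -(mul0mx _ A) => /(row_free_inj fA)/matrixP/(_ 0 (f i).1).
have [ti ri] := fE _ ci0.
rewrite summxE (bigD1 i) //= big1 => [|j /andP[cj ji]].
  rewrite !mxE !eqxx mulr1 addr0 => /eqP; rewrite mulf_eq0 invr_eq0 (negPf ci0).
  by rewrite gt_eqF.
rewrite !mxE /=; have [fij|] := eqVneq (f i).1 (f j).1; last by rewrite mulr0.
have [tj] := fE _ cj; rewrite -fij ri => /(congr1 (fun v => (f i).2^-1 *: v)).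
rewrite !scalerA mulVf ?gt_eqF // scale1r => /ray_generator_inj eij.
by rewrite eij ?eqxx // in ji; rewrite mulr_ge0 // ?invr_ge0 ltW.
Qed.

(** Each row of a free generator matrix spans a face of dimension 1, which is one of the enumerated
    rays. *)
Lemma cone_ray_combination sigma v : Sigma sigma -> sigma v ->
  exists c : 'I_n -> R, [/\ forall i, 0 <= c i, forall i, c i != 0 -> sigma (e i)
    & v = \sum_i c i *: e i].
Proof.
move=> Ss sv; have [m [A [fA sE]]] := simplS Ss; subst sigma.
have /choice[f fE] : forall r, exists it : 'I_n * R, 0 <= it.2 /\ row r A = it.2 *: e it.1.
  move=> r; have : Sigma (ray (row r A)) by apply: (fan_face fanS Ss); exact: is_face_ray_row.
  move=> Sr; have : [set tau | Sigma tau /\ has_dim tau 1] (ray (row r A)).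
    by split=> //; exact/has_dim_ray/row_free_row_neq0.
  rewrite -raysS.2 => -[i _ riE]; have := ray_refl (row r A).
  by rewrite -riE rhoE => -[t t0 rE]; exists (i, t).
have [l l0 ->] := sv.
exists (fun i => \sum_(r | (f r).1 == i) l 0 r * (f r).2); split=> [i|i|].
- by apply: sumr_ge0 => r _; rewrite mulr_ge0 // (fE r).1.
- move=> ci; have [r /andP[/eqP fr]] : exists r, ((f r).1 == i) && (l 0 r * (f r).2 != 0).
    apply/existsP; apply: contraNT ci => /existsPn H.
    by rewrite big1 // => r fr; have := H r; rewrite fr negbK => /eqP.
  rewrite mulf_eq0 negb_or => /andP[_ fr2]; have [fr0 frE] := fE r.
  have -> : e i = (f r).2^-1 *: row r A by rewrite frE fr scalerA mulVf ?scale1r.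
  by apply: cone_ofZ (cone_of_row _ _); rewrite invr_ge0.
- rewrite mulmx_sum_row (partition_big (fun r => (f r).1) xpredT) //=.
  apply: eq_bigr => i _; rewrite scaler_suml; apply: eq_bigr => r /eqP <-.
  by rewrite (fE r).2 scalerA.
Qed.

(* The face of sigma cut out by tau contains every ray entering with a positive
   coefficient in a point of both cones. *)
Lemma no_common_point sigma tau (c : 'I_n -> R) : Sigma sigma -> Sigma tau ->
  (forall i, 0 < c i -> sigma (e i)) -> (forall i, c i < 0 -> tau (e i)) ->
  \sum_i c i *: e i = 0 -> forall i, c i = 0.
Proof.
move=> Ss St cs ct ce.
have [m [A [fA sE]]] := simplS Ss; have [m' [A' [fA' tE]]] := simplS St.
pose v := \sum_(i | 0 < c i) c i *: e i.
have vE : v = \sum_(i | ~~ (0 < c i)) (- c i) *: e i.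
  have := ce; rewrite (bigID (fun i => 0 < c i)) /= -/v => /eqP.
  rewrite addr_eq0 -sumrN => /eqP->.
  by apply: eq_bigr => i _; rewrite scaleNr.
have sv : sigma v.
  rewrite sE; apply: cone_of_sum => i ci; first exact: ltW.
  by rewrite -sE => _; exact: cs.
have tv : tau v.
  rewrite vE tE; apply: cone_of_sum => i; rewrite -leNgt => ci; first by rewrite oppr_ge0.
  by rewrite oppr_eq0 -tE => ci0; apply: ct; rewrite lt_neqAle ci0.
have [[u u0 uE] _] := fan_meet fanS Ss St.
have : (sigma `&` tau) v by split.
rewrite uE /v => -[_ /=]; rewrite mulmx_suml summxE => /eqP.
rewrite psumr_eq0 => [/allP euv|i ci]; last first.
  by rewrite -scalemxAl mxE; apply: mulr_ge0; [exact: ltW|apply: u0; exact: cs].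
(* It remains to see that the rays with positive coefficient lie in [tau] too: [u] kills the sum of
   these terms, hence each of them. *)
apply: (cone_rays_free St) ce => i ci; have [ci0|ci0] := ltP 0 (c i); last first.
  by apply: ct; rewrite lt_neqAle ci.
suff : (sigma `&` tau) (e i) by case.
rewrite uE; split; first exact: cs.
have := euv i; rewrite mem_index_enum ci0 => /(_ isT) /=.
by rewrite -scalemxAl mxE mulf_eq0 (negPf ci) => /eqP.
Qed.

End FanRelations.

(** * Relations among all rays of a complete fan *)

Section CompleteFans.
Variables (R : realType) (d n : nat).
Variables (Sigma : set (set 'rV[R]_d)) (rho : 'I_n -> set 'rV[R]_d).
Hypotheses (d_gt0 : (0 < d)%N) (fanS : is_fan Sigma) (simplS : simplicial_fan Sigma).
Hypotheses (completeS : complete_fan Sigma) (raysS : enumerates_rays Sigma rho).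
Variable e : 'I_n -> 'rV[R]_d.
Hypotheses (e_neq0 : forall i, e i != 0) (rhoE : forall i, rho i = ray (e i)).

Let E : 'M[R]_(n, d) := \matrix_i e i.

Let mulE (r : 'rV_n) : r *m E = \sum_i r 0 i *: e i.
Proof. by rewrite mulmx_sum_row; apply: eq_bigr => i _; rewrite rowK. Qed.

Lemma complete_fan_cone v : exists2 sigma, Sigma sigma & sigma v.
Proof. by have : setT v by []; rewrite -completeS => -[sigma]; exists sigma. Qed.

Lemma ray_generators_row_full : row_full E.
Proof.
rewrite -sub1mx; apply/row_subP => j.
have [sigma Ss sv] := complete_fan_cone (row j 1%:M).
have [c [_ _ ->]] := cone_ray_combination fanS simplS raysS rhoE Ss sv.
have -> : \sum_i c i *: e i = (\row_i c i) *m E.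
  by rewrite mulE; apply: eq_bigr => i _; rewrite mxE.
exact: submxMl.
Qed.

Lemma rank_ray_relations : \rank (kermx E) = (n - d)%N.
Proof. by rewrite mxrank_ker (eqP ray_generators_row_full). Qed.

(** The cone [sigma] is one containing [- e i], written in terms of its rays; moving [e i] to the
    other side gives a nonnegative relation, positive at [i]. *)
Lemma opposite_ray_relation i : exists sigma, exists c : 'I_n -> R,
  [/\ Sigma sigma, forall j, 0 <= c j, forall j, c j != 0 -> sigma (e j)
    & (\row_j (c j + (j == i)%:R)) *m E = 0].
Proof.
have [sigma Ss sv] := complete_fan_cone (- e i).
have [c [c0 cs cE]] := cone_ray_combination fanS simplS raysS rhoE Ss sv.
exists sigma, c; split => //; rewrite mulE.
under eq_bigr do rewrite mxE scalerDl.
rewrite big_split /= -cE (bigD1 i) //= big1 => [|j /negPf->]; last by rewrite scale0r.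
by rewrite eqxx scale1r addr0 addNr.
Qed.

Let opposite_relation_neq0 (c : 'I_n -> R) i :
  (forall j, 0 <= c j) -> (\row_j (c j + (j == i)%:R)) 0 i != 0.
Proof. by move=> c0; rewrite mxE eqxx gt_eqF // ltr_wpDl. Qed.

Lemma dim_lt_rays : (d < n)%N.
Proof.
have n0 : (0 < n)%N.
  by apply: leq_trans d_gt0 _; rewrite -(eqP ray_generators_row_full) rank_leq_row.
have [sigma [c [_ c0 _ /sub_kermxP cE]]] := opposite_ray_relation (Ordinal n0).
rewrite -subn_gt0 -rank_ray_relations lt0n mxrank_eq0.
apply: contraNneq (opposite_relation_neq0 (Ordinal n0) c0) => K0.
by move: cE; rewrite K0 submx0 => /eqP->; rewrite mxE.
Qed.

Lemma no_cone_all_rays sigma : Sigma sigma -> exists i, ~ sigma (e i).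
Proof.
move=> Ss; apply: contrapT => /forallNP se.
have [r /rV0Pn[i ri] rE] := exists_left_kernel E dim_lt_rays.
have : r 0 i = 0; last by move/eqP; apply/negP.
rewrite mulE in rE; apply: (cone_rays_free fanS simplS raysS e_neq0 rhoE Ss _ rE) => j _.
exact: contrapT.
Qed.

(** Here the relations form a line. If the relation obtained from [- e i] vanished at some [j] other
    than [i], so would its multiple obtained from [- e j], which is positive at [j]. Thus the cone
    around [- e i] contains all other rays. *)
Lemma facet_cones i : n = d.+1 ->
  exists2 sigma, Sigma sigma & forall j, j != i -> sigma (e j).
Proof.
move=> nd; have [sigma [c [Ss c0 cs cE]]] := opposite_ray_relation i.
exists sigma => // j ji; apply: cs; apply/negP => /eqP cj.
have [_ [c' [_ c0' _ cE']]] := opposite_ray_relation j.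
set r := \row_j _ in cE; set r' := \row_j _ in cE'.
have r0 : r != 0 by apply/rV0Pn; exists i; exact: opposite_relation_neq0.
have rK : (kermx E <= r)%MS.
  have rK : (r <= kermx E)%MS by exact/sub_kermxP.
  by rewrite -(geq_leqif (mxrank_leqif_sup rK)) rank_ray_relations rank_rV r0 leq_subLR addn1 nd.
have /sub_rVP[a r'E] : (r' <= r)%MS by apply: submx_trans rK; exact/sub_kermxP.
have := opposite_relation_neq0 j c0'; rewrite -/r' r'E !mxE cj (negPf ji).
by rewrite addr0 mulr0 eqxx.
Qed.

(** Fan analogue of the fact that a [d]-polytope which is more than [[d/2]]-neighborly is a
    simplex. *)
Lemma neighborly_rays :
  (forall G : {set 'I_n}, (#|G| <= d./2.+1)%N ->
    exists2 sigma, Sigma sigma & forall i, i \in G -> sigma (e i)) ->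
  n = d.+1.
Proof.
move=> nbh; apply/eqP; rewrite eqn_leq dim_lt_rays andbT leqNgt; apply/negP => dn.
pose f : 'I_d.+2 -> 'I_n := widen_ord dn.
have f_inj : injective f by move=> i j /(congr1 val) ij; exact: val_inj.
have [||r [r0 rE rp rn]] := @exists_balanced_relation _ _ _ d./2.+1 (\matrix_i e (f i)).
(* For [m = d + 2] and [k = d./2 + 1], the bound [m <= 2k + 1] says that [d] is at most
   [2 * d./2 + 1]. *)
- by rewrite doubleS !ltnS -{1}(odd_double_half d) -add1n leq_add2r leq_b1.
- by [].
(* The relation among [d + 2] rays is extended by 0 to all [n] rays. *)
pose c i := \sum_(j | f j == i) r 0 j.
have cf j : c (f j) = r 0 j.
  by rewrite /c (big_pred1 j) // => j'; rewrite (inj_eq f_inj).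
have cN i : c i != 0 -> exists j, i = f j.
  move=> ci; have [j /eqP<-] : exists j, f j == i; last by exists j.
  apply/existsP; apply: contraNT ci => /existsPn H.
  by rewrite /c big_pred0 // => j; exact: negbTE (H j).
have [sigma Ss cs] : exists2 sigma, Sigma sigma & forall i, 0 < c i -> sigma (e i).
  have [|sigma Ss H] := nbh (f @: pos_support r); first by rewrite card_imset.
  exists sigma => // i ci; have [j ij] := cN i (lt0r_neq0 ci); subst i.
  by apply: H; rewrite imset_f // inE -cf.
have [tau St ct] : exists2 tau, Sigma tau & forall i, c i < 0 -> tau (e i).
  have [|tau St H] := nbh (f @: neg_support r); first by rewrite card_imset.
  exists tau => // i ci; have [j ij] := cN i (ltr0_neq0 ci); subst i.
  by apply: H; rewrite imset_f // inE -cf.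
have ce : \sum_i c i *: e i = 0.
  rewrite -[RHS]rE mulmx_sum_row [RHS](partition_big f xpredT) //=.
  apply: eq_bigr => i _; rewrite scaler_suml; apply: eq_bigr => j /eqP <-.
  by rewrite rowK.
have /rV0Pn[j] := r0.
by rewrite -cf (no_common_point fanS simplS raysS e_neq0 rhoE Ss St cs ct ce) eqxx.
Qed.

End CompleteFans.

(** * Irreducible closed subsets of affine space *)

Section AffineSpace.
Variables (R : realType) (n : nat).
Local Notation C := R[i].
Local Notation S := (mpoly n C).
Local Notation An := 'rV[C]_n.
Local Notation ev x f := (meval (x 0) f).
Implicit Types (Y : set An) (f g : S) (G : {set 'I_n}).

Lemma zclosed_cut Y f : zclosed Y -> zclosed (Y `&` [set x : An | ev x f = 0]).
Proof.
move=> [I ->]; exists (I `|` [set f]); apply/seteqP; split=> x.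
  by move=> [xI xf] g [/xI|->].
by move=> xIf; split=> [g Ig|]; apply: xIf; [left|right].
Qed.

Lemma irreducible_prime Y f g : zirreducible Y ->
  (forall x, Y x -> ev x f * ev x g = 0) ->
  (forall x, Y x -> ev x f = 0) \/ (forall x, Y x -> ev x g = 0).
Proof.
move=> [_ Yc Yirr] fg.
have [|||YE|YE] := Yirr (Y `&` [set x : An | ev x f = 0]) (Y `&` [set x : An | ev x g = 0]).
- exact: zclosed_cut.
- exact: zclosed_cut.
- rewrite -setIUr; apply/esym/setIidl => x /fg/eqP; rewrite mulf_eq0.
  by case/orP => /eqP; [left|right].
- by left=> x; rewrite YE => -[].
- by right=> x; rewrite YE => -[].
Qed.

Lemma irreducible_prime_prod Y (I : finType) (P : pred I) (F : I -> S) :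
  zirreducible Y -> (forall x, Y x -> ev x (\prod_(i | P i) F i) = 0) ->
  exists2 i, P i & forall x, Y x -> ev x (F i) = 0.
Proof.
move=> Yirr; suff H (r : seq I) : (forall x, Y x -> ev x (\prod_(i <- r | P i) F i) = 0) ->
    exists2 i, P i & forall x, Y x -> ev x (F i) = 0 by exact: H.
elim: r => [|i r IHr].
  have [[x Yx] _ _] := Yirr.
  by move=> /(_ x Yx)/eqP; rewrite big_nil meval1 oner_eq0.
rewrite big_cons; case: ifP => // Pi H.
have [x /H|?|/IHr//] := @irreducible_prime Y (F i) (\prod_(j <- r | P j) F j) Yirr.
  by rewrite mevalM.
by exists i.
Qed.

Definition line_restriction (p v : An) f : {poly C} :=
  mmap polyC (fun i => (p 0 i)%:P + (v 0 i)%:P * 'X) f.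

Lemma horner_line_restriction p v f t : (line_restriction p v f).[t] = ev (p + t *: v) f.
Proof.
rewrite /line_restriction /meval /mmap horner_sum; apply: eq_bigr => m _.
rewrite hornerM hornerC /mmap1 horner_prod; congr (_ * _); apply: eq_bigr => i _.
by rewrite horner_exp hornerD hornerM !hornerC hornerX !mxE mulrC.
Qed.

Lemma poly_all_roots (q : {poly C}) : (forall t, q.[t] = 0) -> q = 0.
Proof.
move=> q0; apply/eqP/negPn/negP => /max_poly_roots H.
(* In characteristic 0 these are [size q] distinct roots, one too many for a nonzero [q]. *)
have := H [seq k%:R | k <- iota 0 (size q)].
rewrite size_map size_iota ltnn => H'; suff : false by []; apply: H'.
  by apply/allP => x _; rewrite rootE q0.
by rewrite map_inj_uniq ?iota_uniq // => i j /eqP; rewrite eqr_nat => /eqP.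
Qed.

Definition coord_subspace G : set An := [set x | forall i, i \in G -> x 0 i = 0].

Lemma coord_subspace_closed G : zclosed (coord_subspace G).
Proof.
exists [set mpolyX C (mnm1 i) | i in [set i | i \in G]].
apply/seteqP; split=> x xG; first by move=> _ [i Gi <-]; rewrite mevalXU xG.
by move=> i Gi; rewrite -mevalXU; apply: xG; exists i.
Qed.

(* Two polynomials not vanishing identically on the subspace are both nonzero on
   the line through points where they do not vanish, hence so is their product. *)
Lemma coord_subspace_irreducible G : zirreducible (coord_subspace G).
Proof.
split; [by exists 0 => i _; rewrite mxE|exact: coord_subspace_closed|].
move=> A B [I AE] [J BE] YE.
have subA : A `<=` coord_subspace G by rewrite YE; left.
have subB : B `<=` coord_subspace G by rewrite YE; right.
have nonzero (K : set S) : ~ coord_subspace G `<=` zero_set K ->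
    exists p, coord_subspace G p /\ exists2 f, K f & ev p f != 0.
  move=> /existsNP[p /not_implyP[Gp]] /existsNP[f /not_implyP[Kf /eqP fp]].
  by exists p; split=> //; exists f.
have [AG|/nonzero[p [Gp [f If fp]]]] := pselect (coord_subspace G `<=` zero_set I).
  by left; apply/seteqP; rewrite AE; split=> //; rewrite -AE.
have [BG|/nonzero[q [Gq [g Jg gq]]]] := pselect (coord_subspace G `<=` zero_set J).
  by right; apply/seteqP; rewrite BE; split=> //; rewrite -BE.
have /eqP : line_restriction p (q - p) f * line_restriction p (q - p) g = 0.
  apply: poly_all_roots => t; rewrite hornerM !horner_line_restriction.
  have : coord_subspace G (p + t *: (q - p)).
    by move=> i Gi; rewrite !mxE Gp // Gq // subrr mulr0 addr0.
  rewrite YE AE BE => -[/(_ f If)->|/(_ g Jg)->]; first by rewrite mul0r.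
  by rewrite mulr0.
(* The line passes at time 0 through [p], where [f] is nonzero, and at time 1 through [q], where [g]
   is. *)
rewrite mulf_eq0 => /orP[] /eqP.
  move=> /(congr1 (fun h => h.[0])); rewrite horner_line_restriction horner0 scale0r addr0.
  by move/eqP; rewrite (negPf fp).
move=> /(congr1 (fun h => h.[1])); rewrite horner_line_restriction horner0 scale1r subrKC.
by move/eqP; rewrite (negPf gq).
Qed.

End AffineSpace.

(** * Growth of the affine Hilbert function along chains *)

Section HilbertFunction.
Variables (R : realType) (n : nat).
Local Notation C := R[i].
Local Notation S := (mpoly n C).
Local Notation An := 'rV[C]_n.
Local Notation ev x f := (meval (x 0) f).
(** [mmeasure mdeg f] is one more than the total degree, and 0 for the zero polynomial. *)
Local Notation degree_le D f := (mmeasure mdeg f <= D.+1)%N.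
Implicit Types (Y : set An) (f g : S).

Lemma degree_leM D D' f g : degree_le D f -> degree_le D' g -> degree_le (D + D') (f * g).
Proof.
have [->|f0] := eqVneq f 0; first by rewrite mul0r msize0.
have [->|g0] := eqVneq g 0; first by rewrite mulr0 msize0.
by move=> fD gD; rewrite msizeM // -subn1 leq_subLR add1n -addnS -addSn; exact: leq_add.
Qed.

(* The affine Hilbert function of Y at D is at least N. *)
Definition hilbert_ge Y (D N : nat) : Prop :=
  exists2 p : 'I_N -> S, forall i, degree_le D (p i) &
    forall c : 'I_N -> C,
      (forall x, Y x -> \sum_i c i * ev x (p i) = 0) -> forall i, c i = 0.

Lemma hilbert_ge0 Y D : hilbert_ge Y D 0.
Proof. by exists (fun=> 0) => [i|c _ []]; rewrite ?msize0. Qed.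

Lemma hilbert_ge_le Y D D' N : (D <= D')%N -> hilbert_ge Y D N -> hilbert_ge Y D' N.
Proof. by move=> DD' [p pD pY]; exists p => // i; exact: leq_trans (pD i) _. Qed.

(** The matrix of values at the points [y t] is diagonal with nonzero entries, which gives
    independence on [Y]. *)
Lemma hilbert_ge_finType Y D (T : finType) (p : T -> S) (y : T -> An) :
  (forall t, degree_le D (p t)) -> (forall t, Y (y t)) ->
  (forall t u, (ev (y u) (p t) != 0) = (t == u)) -> hilbert_ge Y D #|T|.
Proof.
move=> pD Yy pyE; exists (p \o enum_val) => [i|c cY i]; first exact: pD.
have := cY _ (Yy (enum_val i)); rewrite (bigD1 i) //= big1 => [|j ji].
  have := pyE (enum_val i) (enum_val i); rewrite eqxx => pi0.
  by rewrite addr0 => /eqP; rewrite mulf_eq0 (negPf pi0) orbF => /eqP.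
have := pyE (enum_val j) (enum_val i); rewrite (inj_eq enum_val_inj) (negPf ji).
by move=> /negbT; rewrite negbK => /eqP->; rewrite mulr0.
Qed.

(** Only monomials with all exponents at most [D] can occur, and there are [(D + 1)^n] of them; a
    longer family is linearly dependent. *)
Lemma hilbert_ge_upper Y D N : hilbert_ge Y D N -> (N <= D.+1 ^ n)%N.
Proof.
move=> [p pD pY]; rewrite leqNgt; apply/negP.
pose T := {ffun 'I_n -> 'I_D.+1}.
have -> : (D.+1 ^ n)%N = #|T| by rewrite card_ffun !card_ord.
pose mon (g : T) : multinom n := Multinom [tuple (g i : nat) | i < n].
move=> /(exists_left_kernel (\matrix_(i, j) mcoeff (mon (enum_val j)) (p i))).
move=> [c /rV0Pn[i ci] cM].
suff cp0 : \sum_i c 0 i *: p i = 0.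
  apply/negP: ci; apply/negPn/eqP; apply: (pY (fun i => c 0 i)) => x _.
  rewrite -[RHS](meval0 (x 0)) -cp0 raddf_sum; apply: eq_bigr => j _.
  by rewrite /= mevalZ.
apply/mpolyP => m; rewrite mcoeff0 raddf_sum /=.
have [mD|/forallPn[k]] := boolP [forall k, m k < D.+1]%N; last first.
  rewrite -leqNgt => Dm; apply: big1 => j _; rewrite mcoeffZ memN_msupp_eq0 ?mulr0 //.
  apply: msize_mdeg_ge; apply: leq_trans (pD j) _.
  by rewrite mdegE (bigD1 k) //=; apply: leq_trans Dm (leq_addr _ _).
pose g : T := [ffun k => inord (m k)].
have gm : mon g = m.
  by apply/mnmP => k; rewrite mnmE ffunE inordK //; exact: (forallP mD).
have /matrixP/(_ 0 (enum_rank g)) := cM; rewrite !mxE => cg; rewrite -[RHS]cg.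
by apply: eq_bigr => j _; rewrite mcoeffZ mxE enum_rankK gm.
Qed.

(* Multiplication by f embeds the functions on Y' into those vanishing on Y. *)
Lemma hilbert_ge_step Y Y' f D E N N' : zirreducible Y' -> Y `<=` Y' ->
  degree_le E f -> (forall x, Y x -> ev x f = 0) -> ~ (forall x, Y' x -> ev x f = 0) ->
  hilbert_ge Y (D + E) N -> hilbert_ge Y' D N' -> hilbert_ge Y' (D + E) (N + N').
Proof.
move=> Y'irr YY' fE fY fY' [p pD pY] [q qD qY'].
exists (fun i => match fintype.split i with inl j => p j | inr j => f * q j end).
  move=> i; case: (fintype.split i) => j; first exact: pD.
  by rewrite addnC; exact: degree_leM.
move=> c cY'.
have cE x : Y' x -> \sum_j c (lshift N' j) * ev x (p j) +
    ev x f * \sum_j c (rshift N j) * ev x (q j) = 0.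
  move=> /cY' cYx; rewrite -[RHS]cYx big_split_ord /= mulr_sumr.
  congr (_ + _); apply: eq_bigr => j _.
    by rewrite (unsplitK (inl j)).
  by rewrite (unsplitK (inr j)) mevalM mulrCA.
have cl : forall j, c (lshift N' j) = 0.
  apply: (pY (fun j => c (lshift N' j))) => x Yx; rewrite -[RHS](cE x (YY' _ Yx)).
  by rewrite fY // mul0r addr0.
(* With the first block gone, [f] times the second combination vanishes on [Y'], and irreducibility
   of [Y'] cancels [f]. *)
have cr : forall j, c (rshift N j) = 0.
  apply: (qY' (fun j => c (rshift N j))) => x Y'x.
  have sumE y : \sum_j c (rshift N j) * ev y (q j) = ev y (\sum_j c (rshift N j) *: q j).
    by rewrite raddf_sum; apply: eq_bigr => j _; rewrite /= mevalZ.
  rewrite sumE; move: x Y'x; have [y Y'y||//] := irreducible_prime Y'irr (f := f)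
    (g := \sum_j c (rshift N j) *: q j); last by move/fY'.
  rewrite -sumE -[RHS](cE y Y'y) [X in _ = X + _]big1 ?add0r // => j _.
  by rewrite cl mul0r.
by move=> i; rewrite -(splitK i); case: (fintype.split i) => j /=.
Qed.

(** Some [f] vanishes on [Y] but not on [Y']. Each multiplication by it costs degree [E] and gains
    [D ^ a] independent functions; repeating it [D] times raises the exponent by one. *)
Lemma hilbert_ge_growth Y Y' a c : zirreducible Y' -> zclosed Y -> Y `<` Y' ->
  (forall D, hilbert_ge Y (c * D) (D ^ a)) ->
  exists c', forall D, hilbert_ge Y' (c' * D) (D ^ a.+1).
Proof.
move=> Y'irr [I YE] [YY' Y'Y] hY.
have [f If fY'] : exists2 f, I f & ~ forall x, Y' x -> ev x f = 0.
  apply: contrapT => H; apply: Y'Y => x Y'x; rewrite YE => f If.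
  by apply: contrapT => fx; apply: H; exists f => // fY'; exact/fx/fY'.
have fY x : Y x -> ev x f = 0 by rewrite YE; apply.
pose E := maxn c (mmeasure mdeg f).
have fE : degree_le E f by rewrite ltnW // ltnS leq_maxr.
(* The induction starts with no function in degree [D * E], and its [D] steps add another
   [D * E]. *)
exists (2 * E)%N => D.
suff H l : hilbert_ge Y' ((D + l) * E) (l * D ^ a).
  by have := H D; rewrite addnn -mul2n mulnAC -expnS.
elim: l => [|l IHl]; first by rewrite mul0n; exact: hilbert_ge0.
rewrite addnS !mulSn addnC; apply: hilbert_ge_step fE fY fY' _ IHl => //.
apply: hilbert_ge_le (hY D); rewrite mulnC -mulSnr leq_mul ?leq_maxl //.
by rewrite ltnW // ltnS leq_addr.
Qed.

(** Lagrange interpolation on the grid of points whose coordinates outside [G] run over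
    [0, ..., D - 1]: among grid points, [p t] is nonzero only at [y t]. *)
Lemma hilbert_ge_coord_subspace (G : {set 'I_n}) D :
  hilbert_ge (@coord_subspace R n G) (n * D) (D ^ (n - #|G|)).
Proof.
pose J : finType := {i : 'I_n | i \notin G}; pose T := {ffun J -> 'I_D}.
have <- : #|T| = (D ^ (n - #|G|))%N.
  rewrite card_ffun card_ord card_sig; congr (_ ^ _)%N.
  by rewrite -[X in (X - _)%N](card_ord n) -(cardC (mem G)) addKn; apply: eq_card.
(* [insub i] is [None] exactly for [i] in [G], where the coordinate has to be 0. *)
pose y (t : T) : An := \row_i (if insub i is Some j then (t j : nat)%:R else 0).
pose p (t : T) : S := \prod_(j : J) \prod_(a < D | a != t j)
  (mpolyX C (mnm1 (val j)) - mpolyC n (a : nat)%:R).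
apply: (@hilbert_ge_finType _ _ T p y).
- move=> t; apply: (@leq_trans (#|J| * D).+1%N); last first.
    by rewrite ltnS leq_mul2r card_sig (leq_trans (max_card _)) ?orbT // card_ord.
  rewrite -sum_nat_const; rewrite /p.
  elim/big_rec2: _ => [|j g e _ ge]; first by rewrite msize1.
  apply: degree_leM ge.
  apply: (@leq_trans (\sum_(a < D | a != t j) 1).+1%N); last first.
    by rewrite ltnS sum1_card (leq_trans (max_card _)) // card_ord.
  elim/big_rec2: _ => [|a g' e' _ ge']; first by rewrite msize1.
  apply: degree_leM ge'; apply: leq_trans (msizeD_le _ _) _.
  by rewrite msizeN msizeX mdeg1 msizeC geq_max /=; case: (_ == _).
- by move=> t i Gi; rewrite mxE insubF // Gi.
move=> t u; rewrite rmorph_prod; apply/prodf_neq0/eqP => [H|-> j _].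
  apply/ffunP => j; have := H j isT; rewrite rmorph_prod => /prodf_neq0/(_ (u j)).
  rewrite /= mevalB mevalXU mevalC mxE valK subrr eqxx => /contraTeq.
  by move=> /(_ isT) ->.
rewrite rmorph_prod; apply/prodf_neq0 => a.
rewrite /= mevalB mevalXU mevalC mxE valK subr_eq0 eqr_nat => + .
by rewrite eq_sym.
Qed.

Lemma chain_from_coord_subspace (G : {set 'I_n}) k :
  chain_from (@coord_subspace R n G) k -> (k <= #|G|)%N.
Proof.
move=> [F [F0 Firr Flt]].
have growth i : (i <= k)%N ->
    exists c, forall D, hilbert_ge (F i) (c * D) (D ^ (n - #|G| + i)).
  elim: i => [|i IHi] ik.
    by exists n => D; rewrite addn0 F0; exact: hilbert_ge_coord_subspace.
  have [c hc] := IHi (ltnW ik); rewrite addnS.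
  by apply: hilbert_ge_growth hc; [exact: Firr|have [] := Firr i (ltnW ik)|exact: Flt].
have [c hc] := growth k (leqnn k).
rewrite leqNgt; apply/negP => Gk.
have Gn : (#|G| <= n)%N by rewrite -[X in (_ <= X)%N]card_ord max_card.
(* If [k] exceeds the size of [G], at least [D^(n+1)] independent functions of degree [c * D] exist.
   Since [(c * D + 1)^n <= (c + 1)^n * D^n], any [D > (c + 1)^n] contradicts the upper bound. *)
have := hilbert_ge_upper (hc (c.+1 ^ n).+1).
rewrite leqNgt => /negP; apply.
have : ((c * (c.+1 ^ n).+1).+1 ^ n <= (c.+1 * (c.+1 ^ n).+1) ^ n)%N.
  by case: (posnP n) => [->//|n0]; rewrite leq_exp2r // mulSn addSn ltnS leq_addl.
move=> /leq_ltn_trans; apply; rewrite expnMn.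
have : ((c.+1 ^ n).+1 ^ n.+1 <= (c.+1 ^ n).+1 ^ (n - #|G| + k))%N.
  by rewrite leq_pexp2l // addnBAC // ltn_subRL addnC ltn_add2l.
by apply: leq_trans; rewrite expnS ltn_pmul2r // expn_gt0.
Qed.

End HilbertFunction.

(** * The locus [Z] and its codimension *)

Section ZLocus.
Variables (R : realType) (d n : nat).
Variables (Sigma : set (set 'rV[R]_d)) (rho : 'I_n -> set 'rV[R]_d).
Local Notation Z := (Z_locus Sigma rho).
Local Notation An := 'rV[R[i]]_n.

Lemma mem_Z_locus (x : An) :
  Z x <-> forall sigma, Sigma sigma -> exists2 i, ~ (rho i `<=` sigma) & x 0 i = 0.
Proof.
split=> [Zx sigma Ss|Zx f [s sB ->]].
  have : meval (x 0) (zhat rho sigma) = 0.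
    apply: Zx; exists [:: (1, zhat rho sigma)]; last by rewrite big_seq1 mul1r.
    by move=> p; rewrite inE => /eqP->; exists sigma.
  rewrite rmorph_prod => /eqP/prodf_eq0[i /asboolPn ri] /=.
  by rewrite mevalXU => /eqP; exists i.
rewrite raddf_sum big_seq big1 // => p /sB[sigma Ss <-] /=.
have [i /asboolPn ri xi] := Zx _ Ss.
by rewrite mevalM rmorph_prod (bigD1 i) //= mevalXU xi mul0r mulr0.
Qed.

Lemma coord_subspace_sub_Z_locus (G : {set 'I_n}) :
  (forall sigma, Sigma sigma -> exists2 i, i \in G & ~ (rho i `<=` sigma)) ->
  coord_subspace G `<=` Z.
Proof.
by move=> GS x xG; apply/mem_Z_locus => sigma /GS[i iG ri]; exists i => //; exact: xG.
Qed.

(** Irreducibility makes the vanishing coordinate independent of the point of [Y]. *)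
Lemma irreducible_sub_Z_locus (Y : set An) sigma : zirreducible Y -> Y `<=` Z ->
  Sigma sigma -> exists2 i, ~ (rho i `<=` sigma) & forall x, Y x -> x 0 i = 0.
Proof.
move=> Yirr YZ Ss.
have [x Yx|i /asboolPn ri Yi] := irreducible_prime_prod (I := 'I_n)
    (P := fun i => ~~ `[< rho i `<=` sigma >])
    (F := fun i => mpolyX R[i] (mnm1 i)) Yirr.
  apply: (YZ x Yx); exists [:: (1, zhat rho sigma)]; last by rewrite big_seq1 mul1r.
  by move=> p; rewrite inE => /eqP->; exists sigma.
by exists i => // x /Yi; rewrite mevalXU.
Qed.

Lemma codim_Z_locus_ge2 : is_fan Sigma -> (forall i, Sigma (rho i)) ->
  (2%:R%:E <= codim Z)%E.
Proof.
move=> fanS rhoS; apply: le_ereal_inf_tmp => _ [Y [Yirr YZ] <-].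
have [sigma Ss] := fan_nonempty fanS.
have [i _ Yi] := irreducible_sub_Z_locus Yirr YZ Ss.
(* Taking the ray [rho i] itself as cone yields a coordinate other than [i]. *)
have [j rj Yj] := irreducible_sub_Z_locus Yirr YZ (rhoS i).
have ij : i != j by apply: contra_notN rj => /eqP->.
apply: ereal_sup_ubound; exists 2%N => //.
(* The chain goes from [Y] through the hyperplane of the [i]-th coordinate to the whole space; the
   basis vectors at [j] and [i] show that the inclusions are strict. *)
exists (fun k => match k with 0 => Y | 1 => coord_subspace [set i]%SET
  | _ => coord_subspace finset.set0 end)%N; split=> //.
- by move=> [|[|k]] _; [exact: Yirr|exact: coord_subspace_irreducible..].
- move=> [|[|//]] _; split.
  + by move=> x Yx k; rewrite inE => /eqP->; exact: Yi.
  + move=> /(_ (delta_mx 0 j)) H.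
    suff /H/Yj : coord_subspace [set i]%SET (delta_mx 0 j : An).
      by rewrite mxE !eqxx => /eqP; rewrite oner_eq0.
    by move=> k; rewrite inE => /eqP->; rewrite mxE (negPf ij) andbF.
  + by move=> x _ k; rewrite inE.
  + move=> /(_ (delta_mx 0 i)) H.
    have /H/(_ i) : coord_subspace finset.set0 (delta_mx 0 i : An) by move=> k; rewrite inE.
    by rewrite inE eqxx mxE !eqxx => /(_ isT)/eqP; rewrite oner_eq0.
Qed.

Lemma codim_Z_locus_le (G : {set 'I_n}) :
  (forall sigma, Sigma sigma -> exists2 i, i \in G & ~ (rho i `<=` sigma)) ->
  (codim Z <= #|G|%:R%:E)%E.
Proof.
move=> GS; apply: ge_ereal_inf; exists (codim_irr (@coord_subspace R n G)).
  exists (coord_subspace G) => //; split; first exact: coord_subspace_irreducible.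
  exact: coord_subspace_sub_Z_locus.
apply: ge_ereal_sup => _ [k /chain_from_coord_subspace kG <-].
by rewrite lee_fin ler_nat.
Qed.

End ZLocus.

Theorem proposition2p8 (R : realType) (d n : nat)
    (Sigma : set (set 'rV[R]_d)) (rho : 'I_n -> set 'rV[R]_d) :
  (0 < d)%N ->
  is_fan Sigma ->
  simplicial_fan Sigma ->
  complete_fan Sigma ->
  enumerates_rays Sigma rho ->
  ((2%:R%:E <= codim (Z_locus Sigma rho))%E /\
   (codim (Z_locus Sigma rho) <= (d./2.+1)%:R%:E)%E) \/
  (n = d.+1 /\ Z_locus Sigma rho = [set 0]).
Proof.
move=> d0 fanS simplS complS raysS.
have rhoS i : Sigma (rho i) by have [] := fan_ray raysS i.
have [e eP] := exists_ray_generators simplS raysS.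
have e0 i := (eP i).1; have rhoE i := (eP i).2.
have rsub sigma i : Sigma sigma -> (rho i `<=` sigma) = sigma (e i).
  exact: ray_sub_cone.
have [[G Gd GS]|noG] := pselect (exists2 G : {set 'I_n}, (#|G| <= d./2.+1)%N &
    forall sigma, Sigma sigma -> exists2 i, i \in G & ~ (rho i `<=` sigma)).
  left; split; first exact: codim_Z_locus_ge2.
  by apply: le_trans (codim_Z_locus_le GS) _; rewrite lee_fin ler_nat.
right; have nd : n = d.+1.
  apply: (neighborly_rays d0 fanS simplS complS raysS e0 rhoE) => G Gd.
  apply: contrapT => GS; apply: noG; exists G => // sigma Ss.
  apply: contrapT => H; apply: GS; exists sigma => // i iG; rewrite -rsub //.
  by apply: contrapT => ri; apply: H; exists i.
split=> //; apply/seteqP; split=> [x /mem_Z_locus Zx|_ ->]; last first.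
  apply/mem_Z_locus => sigma Ss.
  have [i si] := no_cone_all_rays d0 fanS simplS complS raysS e0 rhoE Ss.
  by exists i; rewrite ?rsub ?mxE.
apply/rowP => i; rewrite mxE.
(* For a cone containing all rays except possibly [i], the coordinate vanishing at [x] can only be
   the [i]-th. *)
have [sigma Ss si] := facet_cones fanS simplS complS raysS rhoE i nd.
have [j rj xj] := Zx _ Ss.
by have [<-//|/si] := eqVneq j i; rewrite -rsub.
Qed.
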